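(* Let $r \geq 1$ be an integer and let $b > 1$ be an integer with $\gcd(2,b) = 1$ such that $2^r b^2$ is almost perfect. Then $$\frac{\sigma(2^r)}{b} < 1 < \frac{\sigma(b)}{b} < \frac{4}{3} < \frac{3}{2} \leq \frac{\sigma(2^r)}{2^r} < 2 < \frac{\sigma(b)}{2^r}.$$
   Context: $\sigma(x)$ denotes the sum of the positive divisors of $x$. A positive integer $y$ is almost perfect if $\sigma(y) = 2y - 1$. *)

(* Defs.v *)
From HB Require Import structures.
From mathcomp Require Import all_boot all_order all_algebra.
Set Implicit Arguments.
Unset Strict Implicit.
Unset Printing Implicit Defensive.

(* [divisors 0 = [:: 1]], so this is the divisor sum for n > 0 only. *)
Definition sigma (n : nat) : nat := \sum_(d <- divisors n) d.

(* The truncated subtraction is exact: 0 < y gives 1 <= 2 * y. *)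
Definition almost_perfect (y : nat) : Prop :=
  0 < y /\ sigma y = 2 * y - 1.

(* Main.v *)
(** Put [N = sigma (2 ^ r) = 2 ^ r.+1 - 1]. By multiplicativity almost
    perfection reads [N * (sigma (b ^ 2) - b ^ 2) = b ^ 2 - 1]. The divisors
    [b] and [1] of [b ^ 2] give [N * (b + 1) <= b ^ 2 - 1], hence [N < b] and
    [2 ^ r.+1 < b + 1 <= sigma b]. Since [d |-> b * d] embeds the divisors of
    [b] into those of [b ^ 2], [sigma b / b <= sigma (b ^ 2) / b ^ 2], and the
    latter is less than [1 + 1 / N <= 4 / 3]. *)
Require Import Defs.
From HB Require Import structures.
From mathcomp Require Import all_boot all_order all_algebra.
From mathcomp Require Import zify.
Import Order.TTheory GRing.Theory Num.Theory.
Local Open Scope ring_scope.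

(** Every lower bound on [sigma] below comes from this: exhibit a duplicate-free list of
    divisors. *)
Lemma leq_sum_divisors_sigma (s : seq nat) (n : nat) :
  uniq s -> {subset s <= divisors n} -> (\sum_(d <- s) d <= sigma n)%N.
Proof.
move=> us sub; rewrite /sigma (bigID (mem s) (r := divisors n)) /=.
rewrite -(big_filter _ (mem s)).
suff E : perm_eq s [seq d <- divisors n | d \in s].
  by rewrite -(perm_big _ E) leq_addr.
apply: uniq_perm => // [|d]; first by rewrite filter_uniq ?divisors_uniq.
by rewrite mem_filter; case: (boolP (d \in s)) => // /sub ->.
Qed.

Lemma sigma_ltn (n : nat) : (1 < n)%N -> (n < sigma n)%N.
Proof.
move=> n1; have n0 := ltnW n1.
have := @leq_sum_divisors_sigma [:: n; 1%N] n.
rewrite !big_cons big_nil addn0 addn1; apply; rewrite /= ?inE ?andbT.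
  by rewrite neq_ltn n1 orbT.
by move=> d; rewrite !inE -dvdn_divisors // => /orP[]/eqP->.
Qed.

Lemma leq_sigma_sqr (n : nat) :
  (1 < n)%N -> (n ^ 2 + n + 1 <= sigma (n ^ 2))%N.
Proof.
move=> n1; have n0 := ltnW n1.
have := @leq_sum_divisors_sigma [:: (n ^ 2)%N; n; 1%N] (n ^ 2).
rewrite !big_cons big_nil addn0 addnA; apply.
  rewrite /= !inE !andbT negb_or; apply/andP; split; last by lia.
  by apply/andP; split; apply/eqP; nia.
move=> d; rewrite !inE -dvdn_divisors ?expn_gt0 ?n0 //.
by case/or3P=> /eqP-> //; apply: dvdn_mulr.
Qed.

Lemma leq_mul_sigma (m n : nat) :
  (0 < m)%N -> (0 < n)%N -> (m * sigma n <= sigma (m * n))%N.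
Proof.
move=> m0 n0; rewrite {1}/sigma big_distrr /= -(big_map (muln m) predT id).
apply: leq_sum_divisors_sigma.
  rewrite map_inj_uniq ?divisors_uniq // => d e /eqP.
  by rewrite eqn_pmul2l // => /eqP.
move=> e /mapP[d]; rewrite -!dvdn_divisors ?muln_gt0 ?m0 // => dn ->.
by rewrite dvdn_pmul2l.
Qed.

(** By coprimality, [(d, e) |-> d * e] is a bijection from pairs of divisors of [m] and [n] to
    divisors of [m * n]; its inverse takes gcds with [m] and with [n]. *)
Lemma sigma_mul (m n : nat) : (0 < m)%N -> (0 < n)%N -> coprime m n ->
  sigma (m * n) = (sigma m * sigma n)%N.
Proof.
move=> m0 n0 cmn.
have gcdE d e : (d %| m)%N -> (e %| n)%N ->
    (gcdn (d * e) m = d) * (gcdn (d * e) n = e).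
  move=> dm en; split.
    rewrite gcdnC Gauss_gcdl; first exact/gcdn_idPr.
    exact: coprime_dvdr en cmn.
  rewrite gcdnC Gauss_gcdr; first exact/gcdn_idPr.
  by rewrite coprime_sym; apply: coprime_dvdl dm cmn.
rewrite /sigma big_distrlr /= -(big_allpairs_dep (h := muln) (F := id)).
apply: perm_big; apply: uniq_perm; first exact: divisors_uniq.
  apply: allpairs_uniq; rewrite ?divisors_uniq //.
  move=> _ _ /allpairsP[[d e] /= [dm en ->]] /allpairsP[[d' e'] /= [dm' en' ->]].
  move: dm en dm' en'; rewrite -!dvdn_divisors // => dm en dm' en' /= E.
  have [] := (gcdE _ _ dm en, gcdE _ _ dm' en').
  by rewrite E => -[<- <-] [-> ->].
move=> d; apply/idP/allpairsP.
  rewrite -dvdn_divisors ?muln_gt0 ?m0 // => dmn.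
  exists (gcdn d m, gcdn d n); split; rewrite -?dvdn_divisors ?dvdn_gcdr //=.
  (* Antisymmetry of divisibility: [d] divides each term of the expanded product of gcds, and
     conversely the two gcds are coprime divisors of [d]. *)
  apply/eqP; rewrite eqn_dvd muln_gcdr dvdn_gcd dvdn_mull //=.
  rewrite muln_gcdl dvdn_gcd dvdn_mulr //= dmn -muln_gcdl -muln_gcdr.
  rewrite Gauss_dvd ?dvdn_gcdl //.
  by apply: coprime_dvdl (coprime_dvdr _ cmn); rewrite dvdn_gcdr.
case=> -[e f] /= []; rewrite -!dvdn_divisors ?muln_gt0 ?m0 // => em fn ->.
exact: dvdn_mul.
Qed.

Lemma sigma_exp2 (r : nat) : sigma (2 ^ r) = (2 ^ r.+1 - 1)%N.
Proof.
have -> : sigma (2 ^ r) = (\sum_(i < r.+1) 2 ^ i)%N.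
  rewrite -(big_mkord predT (fun i => 2 ^ i)%N) /index_iota subn0.
  rewrite -(big_map (expn 2) predT id) /sigma.
  apply: perm_big; apply: uniq_perm; first exact: divisors_uniq.
    by rewrite map_inj_uniq ?iota_uniq //; apply: expnI.
  move=> d; rewrite -dvdn_divisors ?expn_gt0 //; apply/dvdn_pfactor/mapP => //.
    by case=> i ir ->; exists i; rewrite ?mem_iota.
  by case=> i; rewrite mem_iota => ir ->; exists i.
(* Geometric sum; at base 2 the factor [2.-1] is 1. *)
by have := predn_exp 2 r.+1; rewrite mul1n subn1.
Qed.

Theorem theorem4 (r b : nat) (hr : (1 <= r)%N) (hb : (1 < b)%N)
    (hgcd : gcdn 2 b = 1%N)
    (hap : almost_perfect (2 ^ r * b ^ 2)%N) :
  (sigma (2 ^ r)%N)%:R / b%:R < 1 :> rat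
  /\ 1 < (sigma b)%:R / b%:R :> rat
  /\ (sigma b)%:R / b%:R < 4%:R / 3%:R :> rat
  /\ 4%:R / 3%:R < 3%:R / 2%:R :> rat
  /\ 3%:R / 2%:R <= (sigma (2 ^ r)%N)%:R / (2 ^ r)%N%:R :> rat
  /\ (sigma (2 ^ r)%N)%:R / (2 ^ r)%N%:R < 2%:R :> rat
  /\ 2%:R < (sigma b)%:R / (2 ^ r)%N%:R :> rat.
Proof.
have b0 : (0 < b)%N := ltnW hb.
have sb := sigma_ltn b hb.
have sb2 := leq_sigma_sqr b hb.
have bsb : (b * sigma b <= sigma (b ^ 2))%N by apply: leq_mul_sigma.
(* This is where [1 <= r] enters: it gives [N >= 3], the source of both [4 / 3] and [3 / 2]. *)
have q2 : (2 <= 2 ^ r)%N by rewrite -{1}(expn1 2) leq_exp2l.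
case: hap => _.
rewrite sigma_mul ?expn_gt0 ?b0 //; last first.
  by rewrite coprimeXl ?coprimeXr // /coprime hgcd.
rewrite sigma_exp2 expnS; move: (2 ^ r)%N q2 => q q2 E.
have q0 : (0 < q)%N by lia.
have Nb : (2 * q - 1 < b)%N.
  rewrite ltnNge; apply/negP => bN.
  (* With [N = 2 * q - 1], the right side is [N * b ^ 2 + b ^ 2 - 1], so [N * (b + 1) < b ^ 2],
     impossible when [b <= N]. *)
  have := leq_mul (leqnn (2 * q - 1)%N) sb2; rewrite E.
  nia.
have sb43 : (sigma b * 3 < 4 * b)%N.
  have : (3 * (sigma (b ^ 2) - b ^ 2) < b ^ 2)%N by nia.
  (* Combine with [bsb] to get [3 * b * sigma b < 4 * b ^ 2], then cancel [b]. *)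
  nia.
rewrite !ltr_pdivrMr ?ltr_pdivlMr ?ler_pdivlMr ?ltr0n //.
(* The constants [4 / 3] and [3 / 2] are still factors; moving their division outermost lets it be
   cleared too. *)
rewrite ![_ / 3%:R * _]mulrAC ![_ / 2%:R * _]mulrAC.
rewrite ltr_pdivlMr ?ltr_pdivrMr ?ler_pdivrMr ?ltr0n //.
rewrite !mul1r -!natrM !ltr_nat ler_nat.
by do !split=> //; lia.
Qed.
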